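(* Let $n>1$ and let $(X_j)_{j\ge1}$ be independent and identically distributed random variables on a probability space $(\Omega,\mathcal{F},\mathbb{P})$ with values in $\{a_1,a_2,\dots,a_n\}\subseteq K_n$. Put $p_i=\mathbb{P}(X_1=a_i)$ and assume $p_i>0$ for all $i=1,2,\dots,n$. Let $P_0=e$, $P_j=X_1X_2\cdots X_j$ (product in $K_n$) for $j\ge1$, and let $T=\inf\{j\ge0\mid P_j=f\}$. Then \[ \mathbb{E}[T]=\sum_{i=1}^n p_i^{-1}. \] In particular, if the $X_j$ are uniformly distributed on $\{a_1,a_2,\dots,a_n\}$, then $\mathbb{E}[T]=n^2$.
   Context: Kiselman's semigroup $K_n$ is the monoid, with unit element $e$, given by generators $a_1,\dots,a_n$ and relations $a_i^2=a_i$ for all $1\le i\le n$, and $a_i a_j a_i = a_j a_i a_j = a_i a_j$ for all $1\le j<i\le n$. The element $f=a_na_{n-1}\cdots a_1$ is the zero element of $K_n$, i.e. $fx=xf=f$ for all $x\in K_n$. The convention $\inf\emptyset=\infty$ is used. *)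

(* Defs.v *)
From HB Require Import structures.
From mathcomp Require Import all_boot all_order all_algebra finmap.
From mathcomp Require Import all_classical all_reals all_analysis.

Set Implicit Arguments.
Unset Strict Implicit.
Unset Printing Implicit Defensive.

Import Order.TTheory GRing.Theory Num.Theory.
Local Open Scope classical_set_scope.
Local Open Scope ring_scope.

(** The monoid with generators [S] and defining relations [r], as the quotient
    of the free monoid [seq S] by the congruence generated by [r]. *)

Inductive congr_gen (S : Type) (r : seq S -> seq S -> Prop) :
  seq S -> seq S -> Prop :=
| congr_rel u v : r u v -> congr_gen r u v
| congr_refl u : congr_gen r u u
| congr_sym u v : congr_gen r u v -> congr_gen r v u
| congr_trans u v w : congr_gen r u v -> congr_gen r v w -> congr_gen r u w
| congr_cat u u' v v' :
    congr_gen r u u' -> congr_gen r v v' -> congr_gen r (u ++ v) (u' ++ v').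

Section PresentedMonoid.
Variables (S : choiceType) (r : seq S -> seq S -> Prop).

Definition congr_genb : rel (seq S) := fun u v => `[< congr_gen r u v >].

Lemma congr_genb_refl : reflexive congr_genb.
Proof. by move=> u; apply/asboolP; exact: congr_refl. Qed.

Lemma congr_genb_sym : symmetric congr_genb.
Proof. by move=> u v; apply/asboolP/asboolP; exact: congr_sym. Qed.

Lemma congr_genb_trans : transitive congr_genb.
Proof.
by move=> v u w /asboolP uv /asboolP vw; apply/asboolP; exact: congr_trans vw.
Qed.

Canonical congr_gen_equiv :=
  EquivRel congr_genb congr_genb_refl congr_genb_sym congr_genb_trans.

Definition presented := {eq_quot congr_genb}%qT.

HB.instance Definition _ := Choice.on presented.
HB.instance Definition _ := EqQuotient.on presented.

Definition presented_class (u : seq S) : presented := (\pi_presented u)%qT.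

Lemma presented_classK x : presented_class (repr x) = x.
Proof. exact: reprK. Qed.

Lemma presented_classP u v :
  presented_class u = presented_class v <-> congr_gen r u v.
Proof.
split=> [/eqP|uv]; first by rewrite /presented_class eqmodE => /asboolP.
by apply/eqP; rewrite /presented_class eqmodE; apply/asboolP.
Qed.

Definition presented_mul (x y : presented) : presented :=
  presented_class (repr x ++ repr y).

Lemma presented_mulE u v :
  presented_mul (presented_class u) (presented_class v)
  = presented_class (u ++ v).
Proof.
by apply/presented_classP/congr_cat; apply/presented_classP;
  rewrite presented_classK.
Qed.

Lemma presented_mulA : associative presented_mul.
Proof.
move=> x y z; rewrite -(presented_classK x) -(presented_classK y).
by rewrite -(presented_classK z) !presented_mulE catA.
Qed.

Lemma presented_1mul : left_id (presented_class [::]) presented_mul.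
Proof. by move=> x; rewrite -(presented_classK x) presented_mulE. Qed.

Lemma presented_mul1 : right_id (presented_class [::]) presented_mul.
Proof. by move=> x; rewrite -(presented_classK x) presented_mulE cats0. Qed.

HB.instance Definition _ := isMonoid.Build presented
  presented_mulA presented_1mul presented_mul1.

Definition presented_gen (s : S) : presented := presented_class [:: s].

Lemma prod_presented_gen u :
  (\prod_(s <- u) presented_gen s)%g = presented_class u.
Proof.
elim: u => [|s u IHu]; first by rewrite big_nil.
by rewrite big_cons IHu; exact: presented_mulE.
Qed.

Lemma prod_presented_genP u v :
  (\prod_(s <- u) presented_gen s)%g = (\prod_(s <- v) presented_gen s)%g
  <-> congr_gen r u v.
Proof. by rewrite !prod_presented_gen; exact: presented_classP. Qed.

End PresentedMonoid.

(** Indices start at 0: the index [i : 'I_n] stands for the generator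
    [a_(i+1)]. *)

Inductive kiselman_rel (n : nat) : seq 'I_n -> seq 'I_n -> Prop :=
| kiselman_ii (i : 'I_n) : kiselman_rel [:: i; i] [:: i]
| kiselman_iji (i j : 'I_n) : (j < i)%N -> kiselman_rel [:: i; j; i] [:: i; j]
| kiselman_jij (i j : 'I_n) : (j < i)%N -> kiselman_rel [:: j; i; j] [:: i; j].

Definition kiselman (n : nat) := presented (@kiselman_rel n).

HB.instance Definition _ n := Monoid.on (kiselman n).

Definition kiselman_gen (n : nat) (i : 'I_n) : kiselman n :=
  presented_gen (@kiselman_rel n) i.

(** [rev_ord] makes this the decreasing product [a_n ... a_1]. *)
Definition kiselman_zero (n : nat) : kiselman n :=
  (\prod_(i < n) kiselman_gen (rev_ord i))%g.

Lemma kiselman_gen_ii n (i : 'I_n) :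
  (kiselman_gen i * kiselman_gen i = kiselman_gen i)%g.
Proof.
have := (prod_presented_genP (@kiselman_rel n) [:: i; i] [:: i]).2
  (congr_rel (kiselman_ii i)).
by rewrite !big_cons !big_nil !mulg1.
Qed.

Lemma kiselman_gen_iji n (i j : 'I_n) :
  (j < i)%N ->
  (kiselman_gen i * kiselman_gen j * kiselman_gen i
   = kiselman_gen i * kiselman_gen j)%g.
Proof.
move=> ji.
have := (prod_presented_genP (@kiselman_rel n) [:: i; j; i] [:: i; j]).2
  (congr_rel (kiselman_iji ji)).
by rewrite !big_cons !big_nil !mulg1 !mulgA.
Qed.

Lemma kiselman_gen_jij n (i j : 'I_n) :
  (j < i)%N ->
  (kiselman_gen j * kiselman_gen i * kiselman_gen j
   = kiselman_gen i * kiselman_gen j)%g.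
Proof.
move=> ji.
have := (prod_presented_genP (@kiselman_rel n) [:: j; i; j] [:: i; j]).2
  (congr_rel (kiselman_jij ji)).
by rewrite !big_cons !big_nil !mulg1 !mulgA.
Qed.

HB.instance Definition _ n := isPointed.Build (kiselman n) 1%g.
HB.instance Definition _ n := @isMeasurable.Build default_measure_display
  (kiselman n) discrete_measurable discrete_measurable0
  discrete_measurableC discrete_measurableU.

Section RandomVariables.
Context d d' (Omega : measurableType d) (V : measurableType d') (R : realType)
  (P : probability Omega R).

Definition mutually_independent (I : choiceType) (X : I -> {RV P >-> V}) :=
  forall (J : {fset I}) (A : I -> set V),
    (forall i, i \in J -> measurable (A i)) ->
    P (\bigcap_(i in [set` J]) X i @^-1` A i)
    = (\prod_(i <- J) P (X i @^-1` A i))%E.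

Definition identically_distributed (I : Type) (X : I -> {RV P >-> V}) :=
  forall (i j : I) (A : set V), measurable A ->
    distribution P (X i) A = distribution P (X j) A.

End RandomVariables.

Definition partial_product (Omega : Type) (M : monoidType)
  (X : nat -> Omega -> M) (j : nat) (w : Omega) : M := (\prod_(k < j) X k w)%g.

(** [ereal_inf set0 = +oo]. *)
Definition hitting_time (R : realType) (Omega M : Type) (Z : nat -> Omega -> M)
  (z : M) (w : Omega) : \bar R :=
  ereal_inf [set (j%:R)%:E | j in [set j : nat | Z j w = z]].
Arguments hitting_time {R Omega M} Z z w.

(* Main.v *)
Require Import Defs.
From mathcomp Require Import all_boot all_order all_algebra finmap.
From mathcomp Require Import all_classical all_reals all_analysis.
From mathcomp Require Import zify lra.

Import Order.TTheory GRing.Theory Num.Theory.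
Import numFieldNormedType.Exports.
Local Open Scope classical_set_scope.
Local Open Scope ring_scope.

(** Each defining relation preserves the set of strictly decreasing words that
    are subwords of a given word, so a word represents [a_n ... a_1] only if it
    contains [a_n ... a_1] as a subword. Conversely, deleting letters by means
    of [a_i u a_i = a_i u] ([u] in letters below [a_i]) and
    [a_i u a_i = u a_i] ([u] in letters above [a_i]) turns every word with this
    subword into [a_n ... a_1]. Hence [T] is the time at which greedy matching
    has seen [a_n], then [a_(n-1)], ..., then [a_1]: a sum of geometric waiting
    times with means [1 / p_i]. *)

(** * Greedy matching of a word as a subword *)

Section GreedyMatching.
Context {S : eqType}.
Implicit Types (t u v : seq S) (x : S).

(** The empty word is a fixed point, so a completed match stays complete. *)
Definition match_step t x : seq S :=
  if t is y :: t' then (if x == y then t' else t) else [::].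

(* The suffix of [t] left after greedily matching [t] as a subword of [u]. *)
Definition unmatched t u : seq S := foldl match_step t u.

Lemma unmatched_nil u : unmatched [::] u = [::].
Proof. by elim: u. Qed.

Lemma unmatched_cat t u v : unmatched t (u ++ v) = unmatched (unmatched t u) v.
Proof. exact: foldl_cat. Qed.

Lemma unmatched_self t : unmatched t t = [::].
Proof. by elim: t => //= x t IHt; rewrite eqxx. Qed.

Lemma unmatched_filter x t u :
  x \notin t -> unmatched t [seq y <- u | y != x] = unmatched t u.
Proof.
elim: u t => [//|y u IHu] [|z t] xt; first by rewrite !unmatched_nil.
have xt' : x \notin t by move: xt; rewrite inE negb_or => /andP[].
rewrite /=; have [->|yx] /= := eqVneq y x.
  rewrite (IHu _ xt); case: eqP xt => // ->; by rewrite mem_head.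
by case: eqP => _; apply: IHu.
Qed.

Lemma sorted_match_step (r : rel S) t x :
  sorted r t -> sorted r (match_step t x).
Proof.
by case: t => //= y t yt; case: ifP => // _; apply: path_sorted yt.
Qed.

Lemma sorted_unmatched (r : rel S) t u : sorted r t -> sorted r (unmatched t u).
Proof. by elim: u t => //= x u IHu t st; apply/IHu/sorted_match_step. Qed.

End GreedyMatching.

(** * The Kiselman relations and the words that represent zero *)

Section Words.
Context {n : nat}.
Implicit Types (i j : 'I_n) (t u v : seq 'I_n).

Local Notation decr := (fun i j : 'I_n => (j < i)%N).

Lemma decr_trans : transitive decr.
Proof. by move=> j i k ji kj; apply: ltn_trans ji. Qed.

Local Notation word u := (\prod_(i <- u) kiselman_gen i)%g.

(** The invariant is the whole remaining suffix, not only its emptiness: this carries the induction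
    through concatenation, where the second factor is matched against what the first one left. *)
Lemma unmatched_congr t u v :
  sorted decr t -> congr_gen (@kiselman_rel n) u v ->
  unmatched t u = unmatched t v.
Proof.
move=> + uv; elim: uv t => {u v}.
- move=> u v uv t.
  suff short x t' : path decr x t' ->
      unmatched (x :: t') u = unmatched (x :: t') v.
    by case: t => [|x t]; [rewrite !unmatched_nil | apply: short].
  (* Both sides of a relation have at most three letters, so at most three letters of the target are
     inspected. *)
  case: uv => [i|i j ji|i j ji]; case: t' => [|y [|z t']] /=;
    repeat (case: eqP => //= ?; subst); lia.
- by [].
- by move=> u v _ IH t st; rewrite IH.
- by move=> u v w _ IH1 _ IH2 t st; rewrite IH1 // IH2.
- move=> u u' v v' _ IHu _ IHv t st; rewrite !unmatched_cat IHu // IHv //.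
  exact: sorted_unmatched.
Qed.

(** Induction on the last letter [j]: the induction hypothesis inserts a copy of [a_i] before [a_j],
    the relation [a_i a_j a_i = a_i a_j] drops the final [a_i], and the copy is removed again. *)
Lemma gen_absorb_gt i u : all (fun j : 'I_n => (j < i)%N) u ->
  (kiselman_gen i * word u * kiselman_gen i = kiselman_gen i * word u)%g.
Proof.
elim/last_ind: u => [_|u j IHu].
  by rewrite big_nil !mulg1 kiselman_gen_ii.
rewrite all_rcons => /andP[ji /IHu IH].
rewrite -cats1 big_cat big_seq1 !mulgA /=.
rewrite -IH -(mulgA _ (kiselman_gen i)) -!mulgA [X in (_ * (_ * X))%g]mulgA.
by rewrite kiselman_gen_iji // !mulgA IH.
Qed.

(** Mirror image: induction on the first letter [j], with the copy of [a_i] inserted after [a_j] and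
    the relation [a_i a_j a_i = a_j a_i]. *)
Lemma gen_absorb_lt i u : all (fun j : 'I_n => (i < j)%N) u ->
  (kiselman_gen i * word u * kiselman_gen i = word u * kiselman_gen i)%g.
Proof.
elim: u => [_|j u IHu]; first by rewrite big_nil mulg1 mul1g kiselman_gen_ii.
move=> /= /andP[ij /IHu IH]; rewrite big_cons -!mulgA.
rewrite -[(word u * kiselman_gen i)%g]IH.
by rewrite !mulgA kiselman_gen_jij // -!mulgA.
Qed.

(** Each further [a_i] is absorbed by the leading one, since the letters kept between them are below
    [i]. *)
Lemma gen_word_filter i u : all (fun j : 'I_n => (j <= i)%N) u ->
  (kiselman_gen i * word u)%g = (kiselman_gen i * word [seq j <- u | j != i])%g.
Proof.
elim/last_ind: u => [//|u j IHu]; rewrite all_rcons => /andP[ji ui].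
rewrite filter_rcons -cats1 big_cat big_seq1 mulgA /= IHu //.
case: eqP => [->|/eqP nji] /=.
  apply: gen_absorb_gt; apply/allP => k; rewrite mem_filter => /andP[ki ku].
  by rewrite /= ltn_neqAle ki (allP ui).
by rewrite -cats1 big_cat big_seq1 mulgA.
Qed.

(** The letters before [i] in the decreasing word [t] exceed [i], so the leading [a_i] is absorbed
    by the one inside [t]. *)
Lemma gen_word_sorted i t : sorted decr t -> i \in t ->
  (kiselman_gen i * word t)%g = word t.
Proof.
move=> st it; case/splitPr: it st => u v.
rewrite big_cat big_cons /= !mulgA => st; congr (_ * _)%g.
apply: gen_absorb_lt.
move: st; rewrite sorted_pairwise ?pairwise_cat; last exact: decr_trans.
case/andP => /allrelP uv _; apply/allP => k ku.
by apply: uv => //; rewrite mem_head.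
Qed.

(** If [v] starts with the largest letter [m], later copies of [m] are deleted; this does not affect
    matching the tail of [t], where [m] does not occur. Any other first letter is absorbed by
    [word t], to which the rest of [v] is equal by the inner induction. *)
Lemma word_matched t v : sorted decr t -> {subset v <= t} ->
  unmatched t v = [::] -> word v = word t.
Proof.
elim: t v => [|m t IHt] v st; first by case: v => // x v /(_ x (mem_head _ _)).
have [mt stt] : all (decr m) t /\ sorted decr t.
  by move: st; rewrite /= (path_sortedE decr_trans) => /andP[].
have mNt : m \notin t by apply/negP => /(allP mt); rewrite ltnn.
elim: v => [//|y v IHv] sub; rewrite /= big_cons.
have subv : {subset v <= m :: t}.
  by move=> k kv; apply: sub; rewrite inE kv orbT.
case: eqP => [-> match_v|_ /(IHv subv) ->]; last first.
  by apply: gen_word_sorted => //; apply: sub; rewrite mem_head.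
rewrite gen_word_filter; last first.
  apply/allP => k /subv; rewrite inE => /predU1P[->|/(allP mt)/ltnW//].
  exact: leqnn.
rewrite (IHt [seq j <- v | j != m]) ?big_cons //.
- move=> k; rewrite mem_filter => /andP[km /subv].
  by rewrite inE (negPf km).
- by rewrite unmatched_filter.
Qed.

(** Matching the one-letter target [[:: j]] separates [a_j] from the other generators. *)
Lemma kiselman_gen_inj : injective (@kiselman_gen n).
Proof.
move=> i j /presented_classP/(unmatched_congr [:: j]) => /(_ isT) /=.
by rewrite eqxx; case: eqP.
Qed.

Definition decreasing_ords : seq 'I_n := [seq rev_ord i | i <- enum 'I_n].

Lemma mem_decreasing_ords i : i \in decreasing_ords.
Proof. by rewrite -(rev_ordK i) map_f // mem_enum. Qed.

Lemma decreasing_ords_sorted : sorted decr decreasing_ords.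
Proof.
rewrite /decreasing_ords sorted_map.
have : sorted (fun i j : 'I_n => (i < j)%N) (enum 'I_n).
  have := iota_ltn_sorted 0 n; rewrite -val_enum_ord sorted_map.
  exact: sub_sorted.
apply: sub_sorted => i j ij; rewrite /=.
by have := ltn_ord j; lia.
Qed.

Lemma kiselman_zeroE : kiselman_zero n = word decreasing_ords.
Proof. by rewrite big_map enumT /kiselman_zero [index_enum _]unlock. Qed.

Lemma prod_gen_eq_zero u :
  (\prod_(i <- u) kiselman_gen i)%g = kiselman_zero n <->
  unmatched decreasing_ords u = [::].
Proof.
rewrite kiselman_zeroE; split=> [/prod_presented_genP uE|].
  by rewrite (unmatched_congr _ _ _ decreasing_ords_sorted uE) unmatched_self.
apply: word_matched; first exact: decreasing_ords_sorted.
by move=> i _; apply: mem_decreasing_ords.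
Qed.

End Words.

(** * Hitting times as sums of indicators *)

(** As [c] persists once true, its first index equals the number of indices where it fails; both
    sides are [+oo] if it never holds. *)
Lemma hitting_series (R : realType) (c : nat -> bool) :
  (forall j, c j -> c j.+1) ->
  ereal_inf [set (j%:R)%:E | j in [set j : nat | c j]] =
  (\sum_(0 <= j <oo) ((~~ c j)%:R : R)%:E)%E.
Proof.
move=> c_step; have c_ge j : (0 <= ((~~ c j)%:R : R)%:E)%E by rewrite lee_fin.
have [[j0 cj0]|nc] := pselect (exists j, c j).
  have := ex_minnP (ex_intro _ j0 cj0) => -[N cN minN].
  have cE j : c j = (N <= j)%N.
    apply/idP/idP => [/minN//|/subnK <-].
    by elim: (j - N)%N => // k; exact: c_step.
  have -> : (\sum_(0 <= j <oo) ((~~ c j)%:R : R)%:E = N%:R%:E)%E.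
    rewrite (nneseries_split 0 N) // add0n [X in (_ + X)%E]eseries0 ?adde0.
      rewrite sumEFin (eq_big_nat _ _ (F2 := fun=> 1)).
        by rewrite sumr_const_nat subn0.
      by move=> j /andP[_ jN]; rewrite cE leqNgt jN.
    by move=> j Nj _; rewrite cE Nj.
  apply/eqP; rewrite eq_le; apply/andP; split.
    by apply: ereal_inf_lbound; exists N.
  by apply: le_ereal_inf_tmp => _ [j cj <-]; rewrite lee_fin ler_nat -cE.
have cF j : c j = false by apply/negP => cj; apply: nc; exists j.
rewrite (_ : [set j | _] = set0); last first.
  by apply/seteqP; split=> j //=; rewrite cF.
rewrite image_set0 ereal_inf0; apply/esym/eqyP => A A0.
apply: le_trans _ (nneseries_lim_ge (Num.truncn A).+1 (fun j _ _ => c_ge j)).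
rewrite sumEFin (eq_bigr (fun=> 1)) => [|j _]; last by rewrite cF.
by rewrite sumr_const_nat subn0 lee_fin ltW // truncnS_gt.
Qed.

(** * Tail probabilities of the matching time and their sum *)

Section MatchingTime.
Context {R : realType} {n : nat} (p : 'I_n -> R).

(** The probability that [j] independent letters of law [p] fail to complete the match of [t],
    computed by conditioning on the first letter. *)
Fixpoint miss_prob (j : nat) (t : seq 'I_n) : R :=
  if j is j'.+1 then \sum_i p i * miss_prob j' (match_step t i)
  else (t != [::])%:R.

Hypotheses (p_gt0 : forall i, 0 < p i) (sum_p : \sum_i p i = 1).

Lemma miss_prob_ge0 j t : 0 <= miss_prob j t.
Proof.
elim: j t => [|j IHj] t /=; first by case: eqP.
by apply: sumr_ge0 => i _; apply: mulr_ge0 => //; apply: ltW.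
Qed.

Lemma miss_prob_nil j : miss_prob j [::] = 0.
Proof. by elim: j => //= j IHj; apply: big1 => i _; rewrite IHj mulr0. Qed.

Lemma miss_probS j x t :
  miss_prob j.+1 (x :: t) =
  p x * miss_prob j t + (1 - p x) * miss_prob j (x :: t).
Proof.
have -> : 1 - p x = \sum_(i | i != x) p i.
  by rewrite -sum_p (bigD1 x) //= addrAC subrr add0r.
rewrite /= (bigD1 x) //= eqxx.
by congr (_ + _); rewrite mulr_suml; apply: eq_bigr => i /negPf ->.
Qed.

(** The summand [1] is the term at [j = 0], where the nonempty target is still unmatched. *)
Lemma series_miss_probS N x t :
  series (miss_prob^~ (x :: t)) N.+1 =
  1 + p x * series (miss_prob^~ t) N +
  (1 - p x) * series (miss_prob^~ (x :: t)) N.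
Proof.
rewrite /series /= big_nat_recl // -addrA; congr (_ + _).
by rewrite !mulr_sumr -big_split; apply: eq_bigr => j _; exact: miss_probS.
Qed.

(* One letter of [t] costs a geometric waiting time: the limits [G] for [t] and
   [L] for [x :: t] satisfy [L = 1 + p x * G + (1 - p x) * L]. *)
Lemma cvg_series_miss_prob t :
  series (miss_prob^~ t) N @[N --> \oo] --> \sum_(i <- t) (p i)^-1.
Proof.
elim: t => [|x t IHt].
  rewrite big_nil; under eq_fun => N.
    rewrite /series /= big1 => [|j _]; last by rewrite miss_prob_nil.
    over.
  exact: cvg_cst.
set G := \sum_(i <- t) _ in IHt; rewrite big_cons -/G.
have px := p_gt0 x.
have nd s : {homo series (miss_prob^~ s) : M N / (M <= N)%N >-> M <= N}.
  apply/nondecreasing_seqP => N; rewrite /series /= big_nat_recr //=.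
  by rewrite lerDl miss_prob_ge0.
have S_le_G N : series (miss_prob^~ t) N <= G.
  rewrite -(cvg_lim (@norm_hausdorff _ _) IHt).
  by apply: nondecreasing_cvgn_le => //; apply/cvg_ex; exists G.
have cvgS : cvgn (series (miss_prob^~ (x :: t))).
  (* Monotonicity and the recursion bound [p x] times a partial sum by [1 + p x * G]. *)
  apply: nondecreasing_is_cvgn => //; exists ((p x)^-1 + G) => _ [N _ <-].
  have := nd (x :: t) N N.+1 (leqnSn N); rewrite series_miss_probS.
  have := S_le_G N; set s := series _ N; set s' := series _ N => sG sS.
  rewrite -(ler_pM2l px) mulrDr mulfV ?gt_eqF //.
  have : p x * s <= p x * G by rewrite ler_pM2l.
  by lra.
have /cvg_ex[L SL] := cvgS.
have S'L : series (miss_prob^~ (x :: t)) N.+1 @[N --> \oo] --> L.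
  by rewrite (cvg_shiftS (series _)).
have S'L' : series (miss_prob^~ (x :: t)) N.+1 @[N --> \oo] -->
    1 + p x * G + (1 - p x) * L.
  under eq_fun do rewrite series_miss_probS.
  by apply: cvgD; [apply: cvgD; [exact: cvg_cst|exact: cvgMl_tmp] |
    exact: cvgMl_tmp].
have LE : L = 1 + p x * G + (1 - p x) * L.
  rewrite -(cvg_lim (@norm_hausdorff _ _) S'L').
  by rewrite (cvg_lim (@norm_hausdorff _ _) S'L).
suff <- : L = (p x)^-1 + G by [].
have px0 : p x != 0 by rewrite gt_eqF.
by apply: (mulfI px0); rewrite mulrDr mulfV //; lra.
Qed.

End MatchingTime.

(** * Random letters and the expected matching time *)

Section LetterProcess.
Context {d : measure_display} {Omega : measurableType d} {R : realType}.
Context (P : probability Omega R) {n : nat} (L : nat -> Omega -> 'I_n).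
Context (p : 'I_n -> R).

Definition letters k j w : seq 'I_n := [seq L i w | i <- iota k j].

Hypothesis mL : forall k i, measurable [set w | L k w = i].
Hypothesis prob_prefix : forall u : seq 'I_n,
  P [set w | letters 0 (size u) w = u] = (\prod_(i <- u) p i)%:E.

Lemma lettersSr j w : letters 0 j.+1 w = rcons (letters 0 j w) (L j w).
Proof. by rewrite /letters -addn1 iotaD map_cat cats1. Qed.

Lemma bigsetU_letter k (A : set Omega) :
  A = \big[setU/set0]_i (A `&` [set w | L k w = i]).
Proof.
rewrite -bigcup_seq; apply/seteqP; split=> [w Aw|w [i _ []//]].
by exists (L k w); [exact: mem_index_enum|].
Qed.

Lemma measurable_letters k j (Q : set (seq 'I_n)) :
  measurable [set w | Q (letters k j w)].
Proof.
elim: j k Q => [|j IHj] k Q.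
  have [Q0|nQ0] := pselect (Q [::]).
    rewrite (_ : [set w | _] = setT) //.
    by apply/seteqP; split=> w _ //; exact: Q0.
  rewrite (_ : [set w | _] = set0) //.
  by apply/seteqP; split=> w //; exact: nQ0.
rewrite [X in measurable X](bigsetU_letter k).
apply: bigsetU_measurable => i _.
rewrite (_ : _ `&` _ =
    [set w | Q (i :: letters k.+1 j w)] `&` [set w | L k w = i]).
  by apply: measurableI => //; apply: (IHj _ [set v | Q (i :: v)]).
by apply/seteqP; split=> w [+ Lw]; rewrite /= -Lw.
Qed.

Lemma prob_letter_split k (A : set Omega) : measurable A ->
  P A = (\sum_i P (A `&` [set w | L k w = i]))%E.
Proof.
move=> mA; rewrite {1}(bigsetU_letter k A) measure_bigsetU_ord //.
  by move=> i; apply: measurableI.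
by move=> i j _ _ [w [[_ /= <-] [_ /= <-]]].
Qed.

Lemma sum_letter_prob : \sum_i p i = 1.
Proof.
have := prob_letter_split 0 _ measurableT; rewrite probability_setT => H.
apply: EFin_inj; rewrite H -sumEFin; apply: eq_bigr => i _.
have := prob_prefix [:: i]; rewrite big_seq1 => <-; congr (P _).
by rewrite setTI; apply/seteqP; split=> w; rewrite /letters /=; [case|move->].
Qed.

(** Fixing a prefix [u] replaces conditioning: in the induction on [j], the next letter moves into
    [u] while the target advances by one [match_step]. *)
Lemma prob_unmatched_after u j t :
  P [set w | letters 0 (size u) w = u /\
             unmatched t (letters (size u) j w) <> [::]] =
  ((\prod_(i <- u) p i) * miss_prob p j t)%:E.
Proof.
elim: j u t => [|j IHj] u t /=.
  have [->|t0] := eqVneq t [::].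
    by rewrite mulr0 (_ : [set w | _] = set0) ?measure0 //;
      apply/seteqP; split=> w //= [].
  rewrite mulr1 -prob_prefix; congr (P _).
  by apply/seteqP; split=> w; [case | move=> wu; split=> //; apply/eqP].
rewrite (prob_letter_split (size u)); last first.
  exact: (measurableI _ _ (measurable_letters 0 (size u) [set u])
    (measurable_letters (size u) j.+1 [set v | unmatched t v <> [::]])).
rewrite mulr_sumr -sumEFin; apply: eq_bigr => i _.
have := IHj (rcons u i) (match_step t i).
rewrite -cats1 big_cat big_seq1 -mulrA cats1 size_rcons => <-; congr (P _).
apply/seteqP; split=> w /=; rewrite lettersSr.
  by move=> [[-> + Li]]; rewrite Li.
by move=> [/rcons_inj[-> ->]].
Qed.

Lemma expected_matching_time t : (forall i, 0 < p i) ->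
  (\int[P]_w \sum_(0 <= j <oo) ((unmatched t (letters 0 j w) != [::])%:R : R)%:E
   = (\sum_(i <- t) (p i)^-1)%:E)%E.
Proof.
move=> p_gt0; pose E j := [set w | unmatched t (letters 0 j w) <> [::]].
have mE j : measurable (E j).
  exact: (measurable_letters 0 j [set v | unmatched t v <> [::]]).
have PE j : P (E j) = (miss_prob p j t)%:E.
  have := prob_unmatched_after [::] j t; rewrite big_nil mul1r => <-.
  by congr (P _); apply/seteqP; split=> w //= [].
have indE j w : (unmatched t (letters 0 j w) != [::])%:R = \1_(E j) w :> R.
  by rewrite indicE; congr (nat_of_bool _)%:R; apply/idP/idP => [/eqP|];
    [rewrite inE|rewrite inE => /eqP].
under eq_integral do under eq_eseriesr do rewrite indE.
(* The terms are nonnegative, so sum and integral can be exchanged. *)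
rewrite integral_nneseries //; last first.
  by move=> j; apply/measurable_realfun.measurable_EFinP.
have intE j : (\int[P]_w (\1_(E j) w)%:E = (miss_prob p j t)%:E)%E.
  by rewrite integral_indic // setIT; exact: PE.
under eq_eseriesr do rewrite intE.
have Scvg := cvg_series_miss_prob p p_gt0 sum_letter_prob t.
rewrite -(cvg_lim (@norm_hausdorff _ _) Scvg) -EFin_lim; last first.
  by apply/cvg_ex; eexists; exact: Scvg.
by congr (limn _); apply/funext => N /=; rewrite sumEFin.
Qed.

End LetterProcess.

(** * Transfer from random letters to products in the semigroup *)

(* The sequence is indexed from 0: [X j] is the random variable X_(j+1). *)
Theorem corollary6p7 (n : nat) (hn : (1 < n)%N)
    (d : measure_display) (Omega : measurableType d) (R : realType)
    (P : probability Omega R) (X : nat -> {RV P >-> kiselman n})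
    (hgen : forall (j : nat) (w : Omega),
       exists i : 'I_n, X j w = kiselman_gen i)
    (hindep : mutually_independent X) (hident : identically_distributed X)
    (p : 'I_n -> R)
    (hp : forall i : 'I_n, P [set w | X 0%N w = kiselman_gen i] = (p i)%:E)
    (hp_gt0 : forall i : 'I_n, 0 < p i) :
  let T : Omega -> \bar R :=
    hitting_time (partial_product (fun j w => X j w)) (kiselman_zero n) in
  (\int[P]_w T w = (\sum_(i < n) (p i)^-1)%:E)%E
  /\ ((forall (j : nat) (i : 'I_n),
         P [set w | X j w = kiselman_gen i] = (n%:R^-1)%:E) ->
      (\int[P]_w T w = (n%:R ^+ 2)%:E)%E).
Proof.
move=> T.
suff ET : (\int[P]_w T w = (\sum_(i < n) (p i)^-1)%:E)%E.
  split=> // unif; rewrite ET; congr (_%:E).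
  have pE i : p i = n%:R^-1 by apply: EFin_inj; rewrite -hp unif.
  under eq_bigr do rewrite pE invrK.
  by rewrite sumr_const card_ord expr2 mulr_natr.
pose L j w := projT1 (cid (hgen j w)).
have XL j w : X j w = kiselman_gen (L j w) by rewrite /L; case: cid.
have LE k i : [set w | L k w = i] = X k @^-1` [set kiselman_gen i].
  by apply/seteqP; split=> w /=; rewrite XL; [move=> ->|move/kiselman_gen_inj].
have mL k i : measurable [set w | L k w = i].
  by rewrite LE; apply: measurable_funPTI.
have PX k i : P (X k @^-1` [set kiselman_gen i]) = (p i)%:E.
  by rewrite -hp; apply: (hident k 0%N [set kiselman_gen i]).
have prob_prefix (u : seq 'I_n) :
    P [set w | letters L 0 (size u) w = u] = (\prod_(i <- u) p i)%:E.
  (* [i0] serves as the default value of [nth]. *)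
  pose i0 := Ordinal (ltnW hn).
  pose J : {fset nat} := [fset k | k in iota 0 (size u)]%fset.
  have JE k : (k \in J) = (k < size u)%N by rewrite !inE mem_iota.
  pose A k : set (kiselman n) := [set kiselman_gen (nth i0 u k)].
  have := hindep J A (fun _ _ => I).
  rewrite (_ : \bigcap_(i in _) _ = [set w | letters L 0 (size u) w = u]).
    move=> ->; rewrite (eq_bigr (fun k => (p (nth i0 u k))%:E)); last first.
      by move=> k _; exact: PX.
    rewrite (perm_big (iota 0 (size u))); last first.
      apply: uniq_perm => [||k]; rewrite ?fset_uniq ?iota_uniq //.
      by rewrite JE mem_iota.
    by rewrite prodEFin [in RHS](big_nth i0) /index_iota subn0.
  apply/seteqP; split=> w /=.
    move=> Aw; apply: (@eq_from_nth _ i0); rewrite size_map size_iota //.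
    move=> k ku.
    rewrite (nth_map 0%N) ?size_iota // nth_iota // add0n.
    by apply: kiselman_gen_inj; rewrite -XL; apply: Aw; rewrite /= JE.
  move=> wu k /=; rewrite JE => ku; rewrite /A /= XL; congr kiselman_gen.
  by rewrite -[in RHS]wu (nth_map 0%N) ?size_iota // nth_iota // add0n.
(* The sum is put in the order of [decreasing_ords]. *)
rewrite (reindex_inj rev_ord_inj) /=.
have := expected_matching_time P L p mL prob_prefix decreasing_ords hp_gt0.
rewrite big_map big_enum /= => <-.
apply: eq_integral => w _; rewrite /T /hitting_time.
pose c j := unmatched decreasing_ords (letters L 0 j w) == [::].
rewrite -(hitting_series R c).
  congr (ereal_inf (image _ _)); apply/funext => j; apply/propext => /=.
  rewrite (_ : partial_product _ j w =
      (\prod_(i <- letters L 0 j w) kiselman_gen i)%g).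
    by rewrite prod_gen_eq_zero; split=> /eqP.
  rewrite big_map /partial_product -(big_mkord xpredT (fun k => X k w)).
  rewrite /index_iota subn0.
  by apply: eq_bigr => k _; rewrite XL.
(* Side condition of [hitting_series]: a completed match persists. *)
move=> j /eqP mj; rewrite /c lettersSr -cats1 unmatched_cat mj.
by rewrite unmatched_nil.
Qed.
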